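(* Let $\Phi\in\mathcal{C}^3(I)$, $I=[x_1,x_N]$, and let $g$ be the rational cubic spline fractal interpolation function (RCSFIF) for $\Phi$ with respect to the Hermite data $\{(x_i,y_i,d_i): i=1,\dots,N\}$, where $y_i=\Phi(x_i)$ and $d_i=\Phi^{(1)}(x_i)$, with scaling factors $\alpha_n$ and shape parameters $u_n,v_n$ ($n=1,\dots,N-1$). Suppose that the functions $q_n$ involved in the iterated function system generating $g$ satisfy, for some real constant $K_0$, $$\left|\frac{\partial q_n(\tau_n,u_n,v_n,\rho)}{\partial\alpha_n}\right|\le K_0\qquad\text{for all } |\tau_n|\in(0,a_n),\ \rho\in[0,1],\ n=1,\dots,N-1 .$$ Then $$\|\Phi-g\|_\infty\le \frac12\|\Phi^{(3)}\|_\infty h^3c+\frac{|\alpha|_\infty}{s(1-|\alpha|_\infty)}\Big\{|u|_\infty M+\frac14\Big[(3|u|_\infty+|v|_\infty)M+|u|_\infty\big(h|d|_\infty+|I|\max\{|d_1|,|d_N|\}\big)\Big]\Big\},$$ where $M=|y|_\infty+\max\{|y_1|,|y_N|\}$, $s=\min\{s_n: n=1,\dots,N-1\}$ with $s_n=u_n+\frac14v_n$, and $c$ is the constant of the classical (zero-scaling) error estimate specified in the context.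
   Context: Let $N>2$, $x_1<x_2<\dots<x_N$, $I=[x_1,x_N]$, $|I|=x_N-x_1$, $I_n=[x_n,x_{n+1}]$, $h_n=x_{n+1}-x_n$, $a_n=h_n/(x_N-x_1)$, and let $L_n:I\to I_n$ be the increasing affine map $L_n(x)=a_nx+b_n$ with $L_n(x_1)=x_n$, $L_n(x_N)=x_{n+1}$ ($n=1,\dots,N-1$). Given Hermite data $\{(x_i,y_i,d_i)\}_{i=1}^N\subset\mathbb{R}^3$, scaling factors $\alpha_n\in\mathbb{R}$ with $|\alpha_n|\le\kappa a_n$ for some fixed $\kappa\in[0,1)$, and shape parameters $u_n>0$, $v_n\in\mathbb{R}$ such that $u_n+v_n\theta(1-\theta)\neq0$ for all $\theta\in[0,1]$, define for $\theta\in[0,1]$ $$q_n(\alpha_n,u_n,v_n,\theta)=\frac{P_n(\alpha_n,u_n,v_n,\theta)}{Q_n(u_n,v_n,\theta)},\qquad Q_n(u_n,v_n,\theta)=u_n+v_n\theta(1-\theta),$$ $$\begin{aligned}P_n={}&u_n(y_n-\alpha_ny_1)(1-\theta)^3\\&+\{(3u_n+v_n)(y_n-\alpha_ny_1)+u_nh_nd_n-\alpha_nu_n(x_N-x_1)d_1\}(1-\theta)^2\theta\\&+\{(3u_n+v_n)(y_{n+1}-\alpha_ny_N)-u_nh_nd_{n+1}+\alpha_nu_n(x_N-x_1)d_N\}(1-\theta)\theta^2\\&+u_n(y_{n+1}-\alpha_ny_N)\theta^3 .\end{aligned}$$ The RCSFIF $g$ is the unique continuous function $g:I\to\mathbb{R}$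 satisfying $$g(L_n(x))=\alpha_ng(x)+q_n\Big(\alpha_n,u_n,v_n,\tfrac{x-x_1}{x_N-x_1}\Big),\qquad x\in I,\ n=1,\dots,N-1 .$$ It belongs to $\mathcal{C}^1(I)$ and satisfies $g(x_i)=y_i$, $g^{(1)}(x_i)=d_i$ for all $i$. The classical rational cubic spline $C$ is the function obtained from the same data and shape parameters with all $\alpha_n=0$, i.e. $C(x)=q_n\big(0,u_n,v_n,\frac{x-x_n}{h_n}\big)$ for $x\in I_n$. Notation: $\|\cdot\|_\infty$ is the sup norm on $I$; $|y|_\infty=\max_{1\le i\le N}|y_i|$, $|d|_\infty=\max_{1\le i\le N}|d_i|$; $|u|_\infty=\max_{1\le n\le N-1}|u_n|$, $|v|_\infty=\max_{1\le n\le N-1}|v_n|$, $|\alpha|_\infty=\max_{1\le n\le N-1}|\alpha_n|$; $h=\max_{1\le n\le N-1}h_n$. The constant $c$: $c_1,\dots,c_{N-1}\ge0$ are constants, $c_n$ independent of $h_n$, for which the classical error estimate $\|\Phi-C\|_\infty\le\frac12\|\Phi^{(3)}\|_\infty\max_{1\le n\le N-1}\{h_n^3c_n\}$ holds (this estimate is taken as given), and $c=\max_{1\le n\le N-1}c_n$. *)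

(* Defs.v *)
From mathcomp Require Import all_boot all_order all_algebra.
From mathcomp Require Import all_classical all_reals all_analysis.

Set Implicit Arguments.
Unset Strict Implicit.
Unset Printing Implicit Defensive.

Import Order.TTheory GRing.Theory Num.Theory.
Import numFieldNormedType.Exports.

Local Open Scope classical_set_scope.
Local Open Scope ring_scope.

(* Indices are 1-based: knots, ordinates and slopes are read at 1 <= i <= N,
   per-interval quantities at 1 <= n <= N - 1, written 1 <= n < N.  Values of
   the sequences outside these ranges are never used. *)

(** Calculus on a closed interval *)

(* Derivative relative to A: the difference quotient only sees points of A, so
   for A = [a, b] it is one-sided at the endpoints. *)
Definition diff_quot (R : realType) (f : R -> R) (t z : R) : R :=
  (f z - f t) / (z - t).

Definition derivable_in (R : realType) (A : set R) (f : R -> R) (t : R) :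
    Prop :=
  cvg (diff_quot f t z @[z --> within A (dnbhs t)]).

Definition derive_in (R : realType) (A : set R) (f : R -> R) (t : R) : R :=
  lim (diff_quot f t z @[z --> within A (dnbhs t)]).

Definition derive_inn (R : realType) (A : set R) (k : nat) (f : R -> R) :
    R -> R :=
  iter k (derive_in A) f.

Definition C_class (R : realType) (A : set R) (k : nat) (f : R -> R) : Prop :=
  (forall j, (j < k)%N ->
     forall t, t \in A -> derivable_in A (derive_inn A j f) t) /\
  (forall j, (j <= k)%N -> {within A, continuous (derive_inn A j f)}).

Definition sup_norm (R : realType) (A : set R) (f : R -> R) : R :=
  sup [set `|f t| | t in A].

(** Finite maxima and minima of sequences, over m <= i < n *)

(* The default 0 is neutral: this is only used on nonnegative families. *)
Definition max_range (R : realType) (m n : nat) (z : nat -> R) : R :=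
  \big[Num.max/0]_(m <= i < n) z i.

Definition max_abs (R : realType) (m n : nat) (z : nat -> R) : R :=
  max_range m n (fun i => `|z i|).

(* The initial value is the first element of the (nonempty) range. *)
Definition min_range (R : realType) (m n : nat) (z : nat -> R) : R :=
  \big[Num.min/z m]_(m <= i < n) z i.

(** Knots *)

Definition knots (R : realType) (N : nat) (x : nat -> R) : Prop :=
  forall n, (1 <= n < N)%N -> x n < x n.+1.

Definition span_itv (R : realType) (N : nat) (x : nat -> R) : set R :=
  `[x 1%N, x N].

Definition span_len (R : realType) (N : nat) (x : nat -> R) : R := x N - x 1%N.

Definition knot_step (R : realType) (x : nat -> R) (n : nat) : R :=
  x n.+1 - x n.

Definition contr_ratio (R : realType) (N : nat) (x : nat -> R) (n : nat) : R :=
  knot_step x n / span_len N x.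

(* The increasing affine map with x_1 |-> x_n and x_N |-> x_(n+1). *)
Definition Lmap (R : realType) (N : nat) (x : nat -> R) (n : nat) (t : R) : R :=
  contr_ratio N x n * t + (x n - contr_ratio N x n * x 1%N).

(** The rational functions q_n = P_n / Q_n; al, un, vn stand for the values of
    the scaling factor and of the two shape parameters *)

Definition rat_Q (R : realType) (un vn th : R) : R := un + vn * (th * (1 - th)).

Definition rat_P (R : realType) (N : nat) (x y d : nat -> R) (n : nat)
    (al un vn th : R) : R :=
  un * (y n - al * y 1%N) * (1 - th) ^+ 3
  + ((3 * un + vn) * (y n - al * y 1%N)
     + un * knot_step x n * d n - al * un * span_len N x * d 1%N)
    * ((1 - th) ^+ 2 * th)
  + ((3 * un + vn) * (y n.+1 - al * y N)
     - un * knot_step x n * d n.+1 + al * un * span_len N x * d N)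
    * ((1 - th) * th ^+ 2)
  + un * (y n.+1 - al * y N) * th ^+ 3.

Definition rat_q (R : realType) (N : nat) (x y d : nat -> R) (n : nat)
    (al un vn th : R) : R :=
  rat_P N x y d n al un vn th / rat_Q un vn th.

Definition scaling_factors (R : realType) (N : nat) (x alpha : nat -> R) :
    Prop :=
  exists kappa : R, 0 <= kappa < 1 /\
    forall n, (1 <= n < N)%N -> `|alpha n| <= kappa * contr_ratio N x n.

Definition shape_parameters (R : realType) (N : nat) (u v : nat -> R) : Prop :=
  forall n, (1 <= n < N)%N ->
    0 < u n /\ forall th : R, 0 <= th <= 1 -> rat_Q (u n) (v n) th != 0.

Definition is_RCSFIF (R : realType) (N : nat) (x y d alpha u v : nat -> R)
    (g : R -> R) : Prop :=
  {within span_itv N x, continuous g} /\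
  forall n, (1 <= n < N)%N -> forall t, t \in span_itv N x ->
    g (Lmap N x n t)
    = alpha n * g t
      + rat_q N x y d n (alpha n) (u n) (v n) ((t - x 1%N) / span_len N x).

(* Neighbouring pieces agree at the knots, so this determines Cs on span_itv. *)
Definition is_classical_spline (R : realType) (N : nat)
    (x y d u v : nat -> R) (Cs : R -> R) : Prop :=
  forall n, (1 <= n < N)%N -> forall t, x n <= t <= x n.+1 ->
    Cs t = rat_q N x y d n 0 (u n) (v n) ((t - x n) / knot_step x n).

(* Main.v *)
Require Import Defs.
From mathcomp Require Import all_boot all_order all_algebra.
From mathcomp Require Import all_classical all_reals all_analysis.
From mathcomp Require Import ring lra.
Import Order.TTheory GRing.Theory Num.Theory.
Import numFieldNormedType.Exports.
Set Implicit Arguments.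
Unset Strict Implicit.
Unset Printing Implicit Defensive.
Local Open Scope classical_set_scope.
Local Open Scope ring_scope.

(* Since [q_n] is affine in [alpha_n], the functional equation of [g] gives, for
   [t = L_n(r)], [g t - C t = alpha_n * (g r - H_n)], where [H_n] is a value of
   the rational Hermite interpolant on the whole interval with data at its two
   endpoints.  Hence [|g - C| <= |alpha| (|g - C| + |C| + |H|)] in sup norm, and
   one solves for [|g - C|].
   The interpolants are bounded by their numerator bound over [s].  When
   [v_n <= 0] this holds because [Q_n >= s_n].  When [v_n > 0] that inequality
   fails, but then the weights of the ordinates are nonnegative with sum [Q_n],
   and [th * (1 - th) / Q_n] is maximal at [th = 1/2]. *)

(** * Finite maxima and minima, sup norms *)

Lemma max_range_ge0 (R : realType) m n (z : nat -> R) : 0 <= max_range m n z.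
Proof. exact: bigmax_ge_id. Qed.

Lemma le_max_range (R : realType) m n (z : nat -> R) i :
  (m <= i < n)%N -> z i <= max_range m n z.
Proof.
by move=> mi; apply: (@le_bigmax_seq _ _ _ _ 0 i xpredT z); rewrite ?mem_index_iota.
Qed.

Lemma max_range_le (R : realType) m n (z : nat -> R) b : 0 <= b ->
  (forall i, (m <= i < n)%N -> z i <= b) -> max_range m n z <= b.
Proof.
move=> b0 zb; rewrite /max_range big_nat_cond; apply: bigmax_le => // i.
by rewrite andbT; exact: zb.
Qed.

Lemma min_range_le (R : realType) m n (z : nat -> R) i :
  (m <= i < n)%N -> min_range m n z <= z i.
Proof.
by move=> mi; apply: (@ge_bigmin_seq _ _ _ _ (z m) i xpredT z); rewrite ?mem_index_iota.
Qed.

Lemma lt_min_range (R : realType) m n (z : nat -> R) b : (m < n)%N ->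
  (forall i, (m <= i < n)%N -> b < z i) -> b < min_range m n z.
Proof.
move=> mn zb; rewrite /min_range big_nat_cond; apply: lt_bigmin => [|i].
  by apply: zb; rewrite leqnn.
by rewrite andbT; exact: zb.
Qed.

Lemma sup_norm_ge0 (R : realType) (A : set R) (f : R -> R) : 0 <= sup_norm A f.
Proof.
rewrite /sup_norm; set E := (X in sup X).
(* A set without a supremum has [sup] equal to the default 0. *)
have [[Ene Eub]|/sup_out ->//] := pselect (has_sup E).
have [z [t At zE]] := Ene.
by apply: le_trans (ub_le_sup Eub _); [exact: (normr_ge0 (f t)) | exists t].
Qed.

Lemma le_sup_norm (R : realType) (A : set R) (f : R -> R) b t :
  (forall r, A r -> `|f r| <= b) -> A t -> `|f t| <= sup_norm A f.
Proof.
move=> fb At; apply: ub_le_sup; last by exists t.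
by exists b => _ [r Ar <-]; exact: fb.
Qed.

Lemma sup_norm_le (R : realType) (A : set R) (f : R -> R) b : A !=set0 ->
  (forall r, A r -> `|f r| <= b) -> sup_norm A f <= b.
Proof.
move=> [t At] fb; apply: ge_sup; first by exists `|f t|, t.
by move=> _ [r Ar <-]; exact: fb.
Qed.

(** With [S] the sup norm of [f], taking suprema in the last hypothesis gives [S <= a * (S + b)],
    which is solved for [S] since [a < 1]. The bound [k] only makes [S] a genuine upper bound; its
    value does not enter the estimate. *)
Lemma sup_norm_contraction (R : realType) (A : set R) (f : R -> R) k a b t :
  (forall r, A r -> `|f r| <= k) -> 0 <= a < 1 ->
  (forall r, A r -> exists2 r', A r' & `|f r| <= a * (`|f r'| + b)) ->
  A t -> `|f t| <= a * b / (1 - a).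
Proof.
move=> fk /andP[a0 a1] fa At.
have le_fS r : A r -> `|f r| <= sup_norm A f by apply: le_sup_norm fk.
have S : sup_norm A f <= a * (sup_norm A f + b).
  apply: sup_norm_le => [|r Ar]; first by exists t.
  have [r' Ar' fr] := fa _ Ar.
  by apply: le_trans fr _; rewrite ler_wpM2l// lerD2r le_fS.
apply: le_trans (le_fS _ At) _.
by rewrite ler_pdivlMr ?subr_gt0//; lra.
Qed.

Lemma continuous_itv_bounded (R : realType) (a b : R) (f : R -> R) :
  a <= b -> {within `[a, b], continuous f} ->
  exists k, forall t, t \in `[a, b] -> `|f t| <= k.
Proof.
move=> ab cf; have [c _ fc] := EVT_max ab cf; have [c' _ fc'] := EVT_min ab cf.
exists (`|f c| + `|f c'|) => t abt.
have := fc t abt; have := fc' t abt.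
have := ler_norm (f c); have := ler_norm (- f c'); rewrite normrN.
have := normr_ge0 (f c); have := normr_ge0 (f c').
by rewrite ler_norml => *; apply/andP; split; lra.
Qed.

(** * Rational Hermite interpolants and their uniform bound *)

Lemma rat_Q_gt0 (R : realType) (un vn th : R) : 0 < un ->
  (forall r : R, 0 <= r <= 1 -> rat_Q un vn r != 0) ->
  0 <= th <= 1 -> 0 < rat_Q un vn th.
Proof.
move=> u0 Qn0 /andP[th0 th1]; rewrite ltNge; apply/negP => Qle0.
(* The sign is reversed so that [p] goes from nonpositive at 0, where [rat_Q] is [un], to
   nonnegative at [th]; a root in between contradicts the nonvanishing of [rat_Q]. *)
pose p : {poly R} := - (un%:P + vn%:P * ('X * (1 - 'X))).
have pE r : p.[r] = - rat_Q un vn r by rewrite /p /rat_Q !hornerE.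
have p_sign : p.[0] <= 0 <= p.[th].
  by rewrite !pE oppr_le0 oppr_ge0 Qle0 andbT /rat_Q mul0r mulr0 addr0 ltW.
have [r /andP[r0 rth]] := poly_ivt th0 p_sign.
by rewrite /root pE oppr_eq0; apply/negP/Qn0; rewrite r0 (le_trans rth).
Qed.

(* The interpolant on an interval of length [l] of ordinates [y0], [y1] and
   slopes [e0 / l], [e1 / l], in the rescaled variable [th]. *)
Definition hermite_frac (R : realType) (un vn y0 y1 e0 e1 th : R) : R :=
  (un * y0 * (1 - th) ^+ 3
   + ((3 * un + vn) * y0 + un * e0) * ((1 - th) ^+ 2 * th)
   + ((3 * un + vn) * y1 - un * e1) * ((1 - th) * th ^+ 2)
   + un * y1 * th ^+ 3) / rat_Q un vn th.

Lemma rat_q_hermite (R : realType) (N : nat) (x y d : nat -> R) (n : nat)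
    (al un vn th : R) :
  rat_q N x y d n al un vn th
  = hermite_frac un vn (y n) (y n.+1)
      (knot_step x n * d n) (knot_step x n * d n.+1) th
    - al * hermite_frac un vn (y 1%N) (y N)
      (span_len N x * d 1%N) (span_len N x * d N) th.
Proof.
by rewrite /rat_q /hermite_frac [al * (_ / _)]mulrA -mulrBl /rat_P; congr (_ / _); ring.
Qed.

Lemma norm_pair_le (R : realDomainType) (a b w1 w2 m : R) :
  `|a| <= m -> `|b| <= m -> `|a * w1 + b * w2| <= m * (`|w1| + `|w2|).
Proof.
move=> am bm; apply: le_trans (ler_normD _ _) _.
by rewrite !normrM mulrDr lerD// ler_wpM2r.
Qed.

(** The bounds [U], [V], [Y], [E] and [s] are kept free so that one estimate serves both the pieces
    of the classical spline and the interpolant on the whole interval. *)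
Lemma hermite_frac_le (R : realType) (un vn y0 y1 e0 e1 th U V Y E s : R) :
  0 < un <= U -> `|vn| <= V -> 0 < s <= un + 1 / 4 * vn -> 0 <= th <= 1 ->
  `|y0| <= Y -> `|y1| <= Y -> `|e0| <= E -> `|e1| <= E ->
  `|hermite_frac un vn y0 y1 e0 e1 th|
  <= (U * Y + 1 / 4 * ((3 * U + V) * Y + U * E)) / s.
Proof.
move=> /andP[u0 uU] vV /andP[s0 sle] /andP[th0 th1] y0Y y1Y e0E e1E.
have Y0 : 0 <= Y := le_trans (normr_ge0 _) y0Y.
have E0 : 0 <= E := le_trans (normr_ge0 _) e0E.
have [V1 V2] : vn <= V /\ - vn <= V by move: vV; rewrite ler_norml; lra.
pose p := th * (1 - th).
have p0 : 0 <= p by rewrite mulr_ge0// subr_ge0.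
have p4 : p <= 1 / 4.
  by have := sqr_ge0 (th - 1 / 2); rewrite /p expr2; lra.
(* The total weights of the ordinates [y0] and [y1] in the numerator. *)
pose w0 := un * (1 - th) ^+ 3 + (3 * un + vn) * ((1 - th) * p).
pose w1 := un * th ^+ 3 + (3 * un + vn) * (th * p).
have wQ : w0 + w1 = rat_Q un vn th by rewrite /w0 /w1 /rat_Q /p; ring.
have QE : rat_Q un vn th = un + vn * p by [].
have Q0 : 0 < rat_Q un vn th.
  rewrite QE; have [v0|v0] := leP 0 vn.
    by have := mulr_ge0 v0 p0; lra.
  by have := ler_wnM2l (ltW v0) p4; lra.
set T := U * Y + _.
(* Both denominators are cleared: the numerator times [s] is to be bounded by [T] times
   [rat_Q un vn th]. *)
rewrite /hermite_frac normrM normfV (gtr0_norm Q0) ler_pdivrMr// [T / s * _]mulrAC.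
rewrite ler_pdivlMr//.
rewrite (_ : _ + _ = (y0 * w0 + y1 * w1)
   + un * p * (e0 * (1 - th) + e1 * (- th))); last by rewrite /w0 /w1 /p; ring.
(* The slopes enter with weights [1 - th] and [- th], whose absolute values sum to 1. *)
have ePart : `|un * p * (e0 * (1 - th) + e1 * (- th))| <= un * p * E.
  rewrite normrM (ger0_norm (mulr_ge0 (ltW u0) p0)).
  apply: ler_wpM2l; first exact: mulr_ge0 (ltW u0) p0.
  apply: le_trans (norm_pair_le _ _ e0E e1E) _.
  by rewrite normrN !ger0_norm ?subr_ge0// subrK mulr1.
have yPart := norm_pair_le w0 w1 y0Y y1Y.
have numLe := le_trans (ler_normD _ _) (lerD yPart ePart).
have c0 : 0 <= (1 - th) ^+ 3 by rewrite exprn_ge0// subr_ge0.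
have c1 : 0 <= th ^+ 3 by rewrite exprn_ge0.
have d0 : 0 <= (1 - th) * p by rewrite mulr_ge0// subr_ge0.
have d1 : 0 <= th * p by rewrite mulr_ge0.
have [v0|v0] := leP 0 vn.
  have w0_ge0 : 0 <= w0 by rewrite /w0 addr_ge0// mulr_ge0//; lra.
  have w1_ge0 : 0 <= w1 by rewrite /w1 addr_ge0// mulr_ge0//; lra.
  rewrite (ger0_norm w0_ge0) (ger0_norm w1_ge0) wQ in numLe.
  apply: le_trans (ler_wpM2r (ltW s0) numLe) _.
  (* From [p <= 1 / 4]: [(un + vn / 4) * p <= un / 4 + vn * p / 4]. *)
  have sp : s * p <= rat_Q un vn th / 4 by rewrite QE; nra.
  have sU : s <= U + 1 / 4 * (3 * U + V) by lra.
  have A1 : s * (Y * rat_Q un vn th)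
      <= (U + 1 / 4 * (3 * U + V)) * (Y * rat_Q un vn th).
    by rewrite ler_wpM2r// mulr_ge0// ltW.
  have A2 : (s * p) * (un * E) <= (rat_Q un vn th / 4) * (U * E).
    apply: ler_pM => //; last exact: ler_wpM2r.
      by rewrite mulr_ge0 ?(ltW s0).
    by rewrite mulr_ge0 ?(ltW u0).
  by rewrite /T; lra.
(* For [vn < 0] the weights may change sign. Replacing [3 * un + vn] by [3 * un - vn] bounds the sum
   of their absolute values by [un - vn * p]. *)
have wLe : `|w0| + `|w1| <= U + 1 / 4 * (3 * U + V).
  have absle : `|3 * un + vn| <= 3 * un - vn.
    by rewrite ler_norml; apply/andP; split; lra.
  have B0 : `|w0| <= un * (1 - th) ^+ 3 + (3 * un - vn) * ((1 - th) * p).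
    apply: le_trans (ler_normD _ _) _.
    rewrite (normrM un) (gtr0_norm u0) (ger0_norm c0).
    by rewrite (normrM (3 * un + vn)) (ger0_norm d0) lerD2l ler_wpM2r.
  have B1 : `|w1| <= un * th ^+ 3 + (3 * un - vn) * (th * p).
    apply: le_trans (ler_normD _ _) _.
    rewrite (normrM un) (gtr0_norm u0) (ger0_norm c1).
    by rewrite (normrM (3 * un + vn)) (ger0_norm d1) lerD2l ler_wpM2r.
  apply: le_trans (lerD B0 B1) _.
  rewrite [leLHS](_ : _ = un * (1 - 3 * p) + (3 * un - vn) * p); last first.
    by rewrite /p; ring.
  by nra.
have sQ : s <= rat_Q un vn th.
  by apply: le_trans sle _; rewrite QE; nra.
have numT : Y * (`|w0| + `|w1|) + un * p * E <= T.
  have A1 := ler_wpM2l Y0 wLe.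
  have A2 : un * p * E <= U * (1 / 4) * E.
    by rewrite ler_wpM2r// ler_pM ?(ltW u0).
  by rewrite /T; lra.
by apply: ler_pM => //; [exact: ltW | exact: le_trans numLe numT].
Qed.

(** * Knots and the affine maps between intervals *)

Lemma knots_cover (R : realType) (N : nat) (x : nat -> R) (t : R) :
  (1 < N)%N -> x 1%N <= t <= x N ->
  exists2 n, (1 <= n < N)%N & x n <= t <= x n.+1.
Proof.
elim: N => // N IH; rewrite ltnS leq_eqVlt => /predU1P[<-|N1] tx.
  by exists 1%N.
have [tN|Nt] := leP t (x N).
  have [|n /andP[n1 nN] nt] := IH N1; first by case/andP: tx => ->.
  by exists n => //; rewrite n1 ltnS ltnW.
by exists N; rewrite ?ltnS ?leqnn ?andbT ?(ltnW N1)// (ltW Nt); case/andP: tx.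
Qed.

Lemma knots_le (R : realType) (N : nat) (x : nat -> R) i j :
  knots N x -> (1 <= i <= j)%N -> (j <= N)%N -> x i <= x j.
Proof.
move=> hx /andP[i1]; elim: j => [|j IH]; first by case: i i1.
rewrite leq_eqVlt => /predU1P[->//|ij] jN.
apply: le_trans (IH ij (ltnW jN)) (ltW (hx _ _)).
by rewrite (leq_trans i1 ij).
Qed.

(** An affine map preserves relative position, so the functional equation of [g] and the formula for
    the classical spline involve the same [th] at [t]. *)
Lemma Lmap_surj (R : realType) (N : nat) (x : nat -> R) n t :
  x n < x n.+1 -> x 1%N < x N -> x n <= t <= x n.+1 ->
  exists2 r, x 1%N <= r <= x N &
    Lmap N x n r = t /\ (r - x 1%N) / span_len N x = (t - x n) / knot_step x n.
Proof.
move=> hn hN /andP[nt tn].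
have s0 : 0 < span_len N x by rewrite subr_gt0.
have k0 : 0 < knot_step x n by rewrite subr_gt0.
pose th := (t - x n) / knot_step x n.
have th0 : 0 <= th by rewrite divr_ge0 ?subr_ge0// ltW.
have th1 : th <= 1 by rewrite ler_pdivrMr// mul1r lerB.
exists (x 1%N + th * span_len N x).
  have : 0 <= th * span_len N x by rewrite mulr_ge0// ltW.
  have : th * span_len N x <= 1 * span_len N x by rewrite ler_wpM2r// ltW.
  by rewrite mul1r {2}/span_len => *; apply/andP; split; lra.
split; last by rewrite addrAC subrr add0r mulfK ?gt_eqF.
rewrite /Lmap /contr_ratio /th; field.
by rewrite !gt_eqF.
Qed.

(** * Error estimate through the classical spline *)

Theorem theorem3 (R : realType) (N : nat) (hN : (2 < N)%N)
  (u v : nat -> R) (huv : shape_parameters N u v)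
  (cn : nat -> R) (hcn : forall n, (1 <= n < N)%N -> 0 <= cn n)
  (x : nat -> R) (hx : knots N x)
  (Phi : R -> R) (hPhi : C_class (span_itv N x) 3 Phi)
  (y d : nat -> R)
  (hy : forall i, (1 <= i <= N)%N -> y i = Phi (x i))
  (hd : forall i, (1 <= i <= N)%N -> d i = derive_in (span_itv N x) Phi (x i))
  (alpha : nat -> R) (halpha : scaling_factors N x alpha)
  (g : R -> R) (hg : is_RCSFIF N x y d alpha u v g)
  (Cs : R -> R) (hCs : is_classical_spline N x y d u v Cs)
  (hclassical :
     sup_norm (span_itv N x) (fun t => Phi t - Cs t)
     <= 1 / 2 * sup_norm (span_itv N x) (derive_inn (span_itv N x) 3 Phi)
        * max_range 1 N (fun n => knot_step x n ^+ 3 * cn n))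
  (K0 : R)
  (hK0 : forall n, (1 <= n < N)%N -> forall tau rho : R,
     0 < `|tau| < contr_ratio N x n -> 0 <= rho <= 1 ->
     `|derive1 (fun al : R => rat_q N x y d n al (u n) (v n) rho) tau| <= K0) :
  let h := max_range 1 N (knot_step x) in
  let c := max_range 1 N cn in
  let alphamax := max_abs 1 N alpha in
  let umax := max_abs 1 N u in
  let vmax := max_abs 1 N v in
  let ymax := max_abs 1 N.+1 y in
  let dmax := max_abs 1 N.+1 d in
  let M := ymax + Num.max `|y 1%N| `|y N| in
  let s := min_range 1 N (fun n => u n + 1 / 4 * v n) in
  sup_norm (span_itv N x) (fun t => Phi t - g t)
  <= 1 / 2 * sup_norm (span_itv N x) (derive_inn (span_itv N x) 3 Phi) * h ^+ 3 * c
     + alphamax / (s * (1 - alphamax))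
       * (umax * M
          + 1 / 4 * ((3 * umax + vmax) * M
                     + umax * (h * dmax
                               + span_len N x * Num.max `|d 1%N| `|d N|))).
Proof.
have N1 : (1 < N)%N by exact: ltnW.
have itvE t : (span_itv N x) t <-> x 1%N <= t <= x N.
  by rewrite /span_itv /= in_itv.
have x1N : x 1%N < x N.
  by apply: lt_le_trans (hx 1%N N1) (knots_le hx _ (leqnn N)).
have len0 : 0 < span_len N x by rewrite subr_gt0.
have step0 n : (1 <= n < N)%N -> 0 < knot_step x n by move=> /hx; rewrite subr_gt0.
have itv0 : span_itv N x !=set0 by exists (x 1%N); apply/itvE; rewrite lexx ltW.
have u0 n (nN : (1 <= n < N)%N) : 0 < u n by case: (huv _ nN).
cbv zeta.
set h := max_range 1 N (knot_step x); set c := max_range 1 N cn.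
set alphamax := max_abs 1 N alpha.
set umax := max_abs 1 N u; set vmax := max_abs 1 N v.
set ymax := max_abs 1 N.+1 y; set dmax := max_abs 1 N.+1 d.
set y1N := Num.max `|y 1%N| `|y N|; set d1N := Num.max `|d 1%N| `|d N|.
set s := min_range 1 N _.
(* Each [u n + 1 / 4 * v n] is the value of the denominator at [th = 1 / 2]. *)
have s0 : 0 < s.
  apply: lt_min_range => // n nN; have [un0 Qn0] := huv _ nN.
  have half01 : 0 <= (1 / 2 : R) <= 1 by lra.
  by have := rat_Q_gt0 un0 Qn0 half01; rewrite /rat_Q; lra.
(* Every [contr_ratio N x n] is at most 1, so [kappa < 1] bounds all the scaling factors. *)
have A01 : 0 <= alphamax < 1.
  rewrite max_range_ge0; have [k [/andP[k0 k1] alk]] := halpha.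
  apply: le_lt_trans k1; apply: max_range_le => // n nN.
  apply: le_trans (alk _ nN) _; rewrite ler_piMr// ler_pdivrMr// mul1r lerB//.
    by case/andP: nN => n1 nN; exact: (knots_le hx).
  by case/andP: nN => n1 nN; apply: (knots_le hx _ (ltnW nN)).
have h0 : 0 <= h by exact: max_range_ge0.
have herm_le n y0 y1 e0 e1 Y E th : (1 <= n < N)%N -> 0 <= th <= 1 ->
    `|y0| <= Y -> `|y1| <= Y -> `|e0| <= E -> `|e1| <= E ->
    `|hermite_frac (u n) (v n) y0 y1 e0 e1 th|
    <= (umax * Y + 1 / 4 * ((3 * umax + vmax) * Y + umax * E)) / s.
  move=> nN; apply: hermite_frac_le.
  - by rewrite u0// (le_trans (ler_norm _))// (le_max_range (fun i => `|u i|)).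
  - exact: (le_max_range (fun i => `|v i|)).
  - by rewrite s0 (min_range_le (fun n => u n + 1 / 4 * v n)).
have y_le i : (1 <= i <= N)%N -> `|y i| <= ymax.
  by move=> iN; apply: (le_max_range (fun i => `|y i|)); rewrite ltnS.
have hd_le n i : (1 <= n < N)%N -> (1 <= i <= N)%N ->
    `|knot_step x n * d i| <= h * dmax.
  move=> nN iN; rewrite normrM ler_pM ?normr_ge0//.
    by rewrite gtr0_norm ?step0// (le_max_range (knot_step x)).
  by apply: (le_max_range (fun i => `|d i|)); rewrite ltnS.
have knot_in n : (1 <= n < N)%N -> (1 <= n <= N)%N /\ (1 <= n.+1 <= N)%N.
  by move=> /andP[n1 nN]; rewrite n1 nN ltnW.
(* [bC] bounds the classical spline and [bH] the interpolant on the whole interval. The sum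
   [ymax + y1N] is the [M] of the statement, so [s * (bC + bH)] is its final bracket. *)
pose bC := (umax * ymax
  + 1 / 4 * ((3 * umax + vmax) * ymax + umax * (h * dmax))) / s.
pose bH := (umax * y1N
  + 1 / 4 * ((3 * umax + vmax) * y1N + umax * (span_len N x * d1N))) / s.
have CE n t : (1 <= n < N)%N -> x n <= t <= x n.+1 ->
    Cs t = hermite_frac (u n) (v n) (y n) (y n.+1)
      (knot_step x n * d n) (knot_step x n * d n.+1) ((t - x n) / knot_step x n).
  by move=> nN nt; rewrite (hCs _ nN _ nt) rat_q_hermite mul0r subr0.
have th01 n t : (1 <= n < N)%N -> x n <= t <= x n.+1 ->
    0 <= (t - x n) / knot_step x n <= 1.
  move=> nN /andP[nt tn]; apply/andP; split.
    by apply: divr_ge0; [rewrite subr_ge0 | exact: ltW (step0 _ nN)].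
  by rewrite ler_pdivrMr ?step0// mul1r lerB.
have C_le t : span_itv N x t -> `|Cs t| <= bC.
  move=> /itvE /(knots_cover N1)[n nN nt]; have [n1 n2] := knot_in _ nN.
  by rewrite (CE _ _ nN nt) herm_le ?th01 ?y_le ?hd_le.
have [gcont geq] := hg.
have [kg g_le] := continuous_itv_bounded (ltW x1N) gcont.
have [kPhi Phi_le] := continuous_itv_bounded (ltW x1N) (hPhi.2 0%N isT).
(* The sup norm dominates pointwise values only for a bounded function, hence the bounds on [Phi]
   and [Cs]. *)
have PhiC t : span_itv N x t ->
    `|Phi t - Cs t| <= sup_norm (span_itv N x) (fun t => Phi t - Cs t).
  apply: (@le_sup_norm _ _ (fun t => Phi t - Cs t) (kPhi + bC)) => r Ar.
  by rewrite (le_trans (ler_normB _ _))// lerD// ?C_le//; exact: Phi_le.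
have gC t : span_itv N x t ->
    `|g t - Cs t| <= alphamax * (bC + bH) / (1 - alphamax).
  apply: (@sup_norm_contraction _ _ (fun t => g t - Cs t) (kg + bC)) => // r Ar.
    by rewrite (le_trans (ler_normB _ _))// lerD// ?C_le//; exact: g_le.
  have /itvE/(knots_cover N1)[n nN nr] := Ar.
  have [r' r'N [Lr' thr']] := Lmap_surj (hx _ nN) x1N nr.
  have Ar' : span_itv N x r' by exact/itvE.
  exists r' => //.
  have := geq n nN r'; rewrite inE Lr' thr' rat_q_hermite -CE// => -> //.
  set H := hermite_frac _ _ _ _ _ _ _.
  rewrite (_ : _ - Cs r = alpha n * (g r' - H)); last by ring.
  rewrite normrM ler_pM ?normr_ge0//; first exact: (le_max_range (fun i => `|alpha i|)).
  (* Inserting [Cs r'] makes the error [g - Cs] reappear at the preimage [r'], as the contraction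
     argument requires; the remainder is at most [bC + bH]. *)
  rewrite (_ : g r' - H = (g r' - Cs r') + (Cs r' - H)); last by ring.
  apply: le_trans (ler_normD _ _) _; rewrite lerD2l.
  apply: le_trans (ler_normB _ _) _; rewrite lerD ?C_le//.
  apply: herm_le => //; rewrite ?th01 ?le_max ?lexx ?orbT//.
  - by rewrite normrM gtr0_norm// ler_wpM2l ?(ltW len0)// le_max lexx.
  - by rewrite normrM gtr0_norm// ler_wpM2l ?(ltW len0)// le_max lexx orbT.
(* The maximum of the products [h_n^3 c_n] is at most the product of the maxima, all factors being
   nonnegative. *)
have classical_le :
    1 / 2 * sup_norm (span_itv N x) (derive_inn (span_itv N x) 3 Phi)
      * max_range 1 N (fun n => knot_step x n ^+ 3 * cn n)
    <= 1 / 2 * sup_norm (span_itv N x) (derive_inn (span_itv N x) 3 Phi)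
      * h ^+ 3 * c.
  rewrite -[leRHS]mulrA ler_wpM2l ?mulr_ge0 ?sup_norm_ge0//.
  apply: max_range_le => [|n nN]; first by rewrite mulr_ge0 ?exprn_ge0 ?max_range_ge0.
  rewrite ler_pM ?exprn_ge0 ?hcn ?(ltW (step0 _ nN))//; last exact: le_max_range.
  by rewrite lerXn2r ?nnegrE ?(ltW (step0 _ nN))// le_max_range.
apply: sup_norm_le => // t At.
rewrite (_ : Phi t - g t = (Phi t - Cs t) - (g t - Cs t)); last by ring.
apply: le_trans (ler_normB _ _) _; apply: lerD.
  exact: le_trans (PhiC _ At) (le_trans hclassical classical_le).
apply: le_trans (gC _ At) _.
(* The bound obtained and the second term of the claim are equal; only the factor [1 / s] is placed
   differently. *)
rewrite le_eqVlt; apply/orP; left; apply/eqP.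
rewrite /bC /bH; field.
by case/andP: A01 => _ A1; rewrite !gt_eqF ?subr_gt0.
Qed.
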